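(* For all $n\ge1$, $$I_n(-1,t)=\sum_{\sigma\in\mathrm{Av}_n(321)}(-1)^{\mathrm{inv}\,\sigma}t^{\mathrm{lrm}\,\sigma}=\sum_{k=1}^n(-1)^{n-k}s_{n,k}\,t^k,\qquad s_{n,k}=\binom{\lfloor (n-1)/2\rfloor}{\lfloor (k-1)/2\rfloor}\binom{\lceil (n-1)/2\rceil}{\lceil (k-1)/2\rceil}.$$ Moreover, for all $n\ge1$, $$I_{2n}(-1,t)=(t-1)\,I_{2n-1}(-1,t),$$ $$(n+1)\,I_{2n+1}(-1,t)=2\big((1+t^2)n-t\big)I_{2n-1}(-1,t)-(1-t^2)^2(n-1)\,I_{2n-3}(-1,t),$$ where for $n=1$ the last term is zero because of the factor $n-1$.
   Context: $\mathrm{Av}_n(321)$ is the set of permutations $\sigma=a_1\ldots a_n$ of $[n]$ with no $i<j<k$ such that $a_i>a_j>a_k$. $\mathrm{inv}\,\sigma=\#\{(i,j):i<j,\ a_i>a_j\}$; $\mathrm{lrm}\,\sigma$ is the number of $i$ with $a_i=\max\{a_1,\dots,a_i\}$. $I_n(q,t)=\sum_{\sigma\in\mathrm{Av}_n(321)}q^{\mathrm{inv}\,\sigma}t^{\mathrm{lrm}\,\sigma}$, and $I_n(-1,t)$ is its specialization at $q=-1$. *)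

(* Defs.v *)
From mathcomp Require Import all_boot all_order all_fingroup all_algebra.

Set Implicit Arguments.
Unset Strict Implicit.
Unset Printing Implicit Defensive.

Import GRing.Theory.
Local Open Scope ring_scope.

(* A permutation a_1 ... a_n of [n] is an element s of 'S_n, with positions and
   values both shifted down by one: a_(i+1) = s i + 1.  Since the order is
   preserved, this changes neither pattern avoidance nor inv nor lrm. *)

Definition avoids321 (n : nat) (s : 'S_n) : bool :=
  ~~ [exists i : 'I_n, exists j : 'I_n, exists k : 'I_n,
       [&& (i < j)%N, (j < k)%N, (s i > s j)%N & (s j > s k)%N]].

Definition Av321 (n : nat) : {set 'S_n} := [set s | avoids321 s].

Definition inv_stat (n : nat) (s : 'S_n) : nat :=
  #|[set p : 'I_n * 'I_n | (p.1 < p.2)%N && (s p.1 > s p.2)%N]|.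

Definition lrm_stat (n : nat) (s : 'S_n) : nat :=
  #|[set i : 'I_n | (s i : nat) == (\max_(j < n | (j <= i)%N) s j)%N]|.

(* I_n(q,t) in Z[t][q]: the outer variable is q, the inner one is t, so that
   (Ipoly n).[-1] : {poly int} is the specialization I_n(-1,t) in Z[t]. *)
Definition Ipoly (n : nat) : {poly {poly int}} :=
  \sum_(s in Av321 n) 'X^(inv_stat s) * ('X^(lrm_stat s))%:P.

Definition s_coef (n k : nat) : nat :=
  ('C((n - 1)./2, (k - 1)./2) * 'C(uphalf (n - 1), uphalf (k - 1)))%N.

(* Main.v *)
(* Build a permutation of [n+1] by appending a last value v (0-based) to a
   permutation s of [n].  If low s is one plus the largest value that is the
   smaller element of an inversion of s, the result avoids 321 exactly when s
   does and low s <= v.  Appending adds n - v inversions, and a left-to-right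
   maximum exactly when v = n; the new height (length minus low) is the old one
   plus 1 if v = n, and n - v otherwise.  So the joint distribution of
   (inv, lrm, height) satisfies a linear recursion.  At q = -1 it is solved
   explicitly: in odd length 2m+1 the part of height at least 2j+1 is
     sum_p C(m-j,p-j) (C(m,p) t^(2p+1) - C(m,p+1) t^(2p+2)),
   the total weight of each even height vanishes, and this cancellation makes
   the step to length 2m+2 a multiplication by t - 1.  The three-term recurrence is then an identity
   between products of two binomial coefficients. *)
Require Import Defs.
From mathcomp Require Import all_boot all_order all_fingroup all_algebra.
From mathcomp Require Import zify ring.

Set Implicit Arguments.
Unset Strict Implicit.
Unset Printing Implicit Defensive.

Import GRing.Theory.
Local Open Scope ring_scope.

(** * Appending a last value: bijection, avoidance and the new [low] *)

Definition low n (s : 'S_n) : nat :=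
  \max_(p : 'I_n * 'I_n | (p.1 < p.2)%N && (s p.2 < s p.1)%N) (s p.2).+1.

Lemma low_leP n (s : 'S_n) x :
  reflect (forall i j : 'I_n, (i < j)%N -> (s j < s i)%N -> (s j < x)%N)
          (low s <= x)%N.
Proof.
rewrite /low; apply: (iffP (bigmax_leqP _ _ _)) => [lx i j ij sij|lx [i j]].
  by apply: (lx (i, j)); rewrite /= ij.
by move=> /andP[]; apply: lx.
Qed.

Lemma low_le n (s : 'S_n) : (low s <= n)%N.
Proof. by apply/low_leP. Qed.

Definition append n (s : 'S_n) (v : 'I_n.+1) : 'S_n.+1 := lift_perm ord_max v s.

Lemma append_max n (s : 'S_n) v : append s v ord_max = v.
Proof. exact: lift_perm_id. Qed.

Lemma append_lift n (s : 'S_n) v i :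
  append s v (lift ord_max i) = lift v (s i).
Proof. exact: lift_perm_lift. Qed.

Definition appendE := (append_max, append_lift, lift_max).

Lemma ltn_lift n (v : 'I_n.+1) (a b : 'I_n) : (lift v a < lift v b)%N = (a < b)%N.
Proof. by rewrite /= /bump; lia. Qed.

Lemma ltn_lift_self n (v : 'I_n.+1) (a : 'I_n) : (v < lift v a)%N = (v <= a)%N.
Proof. by rewrite /= /bump; lia. Qed.

(** Group the permutations of [n+1] by their last value v. For fixed v, deleting the last entry and
    standardising the rest inverts [append]. *)
Lemma sum_append (R : nmodType) n (F : 'S_n.+1 -> R) :
  \sum_s F s = \sum_(s : 'S_n) \sum_v F (append s v).
Proof.
rewrite exchange_big /= (partition_big (fun s : 'S_n.+1 => s ord_max) predT) //=.
apply: eq_bigr => v _; rewrite (reindex (@append n ^~ v)) /=.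
  by apply: eq_bigl => s; rewrite append_max eqxx.
(* The default [k] is never returned: by injectivity no other position takes the value at [ord_max],
   so [unlift] succeeds. *)
pose f (s : 'S_n.+1) k := odflt k (unlift (s ord_max) (s (lift ord_max k))).
have fK (s : 'S_n.+1) k : lift (s ord_max) (f s k) = s (lift ord_max k).
  rewrite /f; have := neq_lift ord_max k.
  by rewrite -(can_eq (permK s)) => /unlift_some[] ? ? ->.
have f_inj s : injective (f s).
  move=> k l /(congr1 (lift (s ord_max))); rewrite !fK.
  by move/perm_inj/lift_inj.
exists (fun s => perm (f_inj s)) => [s _ | s]; rewrite ?inE.
  by apply/permP=> k; rewrite permE /f !appendE liftK.
move/eqP => sv; apply/permP=> k.
case: (unliftP ord_max k) => [k'|] ->; rewrite appendE //.
by rewrite -sv permE fK.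
Qed.

Lemma avoids321P n (s : 'S_n) :
  reflect (forall i j k : 'I_n, (i < j)%N -> (j < k)%N -> (s j < s i)%N ->
             (s k < s j)%N -> False) (avoids321 s).
Proof.
apply: (iffP idP) => [/existsPn H i j k ij jk sij sjk|H].
  by move/existsPn: (H i) => /(_ j) /existsPn /(_ k); rewrite ij jk sij sjk.
apply/existsPn => i; apply/existsPn => j; apply/existsPn => k.
by apply/negP => /and4P[]; apply: H.
Qed.

(** A new 321 pattern must end at the last position, hence extend an inversion of [s] whose smaller
    value b lies above the new entry. After the shift of old values this means v <= b, so avoidance
    asks b < v for every such b. *)
Lemma avoids321_append n (s : 'S_n) v :
  avoids321 (append s v) = avoids321 s && (low s <= v)%N.
Proof.
apply/avoids321P/andP => [H|[/avoids321P Hs /low_leP Hl] i j k].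
  split.
    apply/avoids321P => i j k ij jk sij sjk.
    by apply: (H (lift ord_max i) (lift ord_max j) (lift ord_max k));
      rewrite ?append_lift ?ltn_lift.
  apply/low_leP => i j ij sij; rewrite ltnNge; apply/negP => vj.
  apply: (H (lift ord_max i) (lift ord_max j) ord_max);
    by rewrite ?append_max ?append_lift ?ltn_lift ?ltn_lift_self ?lift_max.
case: (unliftP ord_max j) => [j'|] ->; last by have := ltn_ord k; rewrite /=; lia.
case: (unliftP ord_max i) => [i'|] ->; last by have := ltn_ord j'; rewrite /= /bump; lia.
rewrite !append_lift !ltn_lift.
case: (unliftP ord_max k) => [k'|] ->; rewrite ?append_lift ?ltn_lift.
  exact: Hs.
rewrite append_max ltn_lift_self => ij _ sij vj.
by have := Hl _ _ ij sij; lia.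
Qed.

(** For v = n no inversion is created and no value shifts. For v < n the new entry ends an
    inversion, and the old smaller elements are below [low s <= v], so they stay unshifted and below
    v. *)
Lemma low_append n (s : 'S_n) (v : 'I_n.+1) : (low s <= v)%N ->
  low (append s v) = if v == n :> nat then low s else v.+1.
Proof.
move=> lv.
have lowE x :
    (low (append s v) <= x)%N = (low s <= x)%N && ((v == n :> nat) || (v < x)%N).
  apply/low_leP/andP => [H|[/low_leP Hl Hv] i j].
    have Hs (i j : 'I_n) : (i < j)%N -> (s j < s i)%N -> (s j < x)%N.
      move=> ij sij; have := low_leP _ _ lv _ _ ij sij.
      have := H (lift ord_max i) (lift ord_max j).
      rewrite !append_lift !ltn_lift => /(_ ij sij) /=; rewrite /bump; lia.
    split; first exact/low_leP.
    case: eqP => //= vn; have v_lt : (v < n)%N by have := ltn_ord v; lia.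
    (* The old value v becomes v + 1 and forms an inversion with the last entry. *)
    have := H (lift ord_max (s^-1 (Ordinal v_lt))%g) ord_max.
    rewrite append_lift append_max permKV ltn_lift_self lift_max; exact.
  case: (unliftP ord_max i) => [i'|] ->; last by have := ltn_ord j; rewrite /=; lia.
  case: (unliftP ord_max j) => [j'|] ->; rewrite ?append_lift ?append_max.
    rewrite !ltn_lift => ij sij; have := Hl _ _ ij sij.
    have := low_leP _ _ lv _ _ ij sij; rewrite /= /bump; lia.
  rewrite ltn_lift_self => _ vi; have := ltn_ord (s i'); lia.
apply/eqP; rewrite eqn_leq lowE.
have := lowE (low (append s v)); rewrite leqnn => /esym/andP[].
case: eqP => //=; lia.
Qed.

(** * Inversions and left-to-right maxima under appending *)

Lemma sum_leq_ord n v : (v <= n)%N -> (\sum_(i < n) (v <= i) = n - v)%N.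
Proof.
elim: n => [|n IH] vn; first by rewrite big_ord0; lia.
rewrite big_ord_recr /=; case: (ltngtP v n.+1) vn => // [vn _|-> _].
  rewrite IH; lia.
rewrite ltnn subnn big1 // => i _; have := ltn_ord i; lia.
Qed.

Lemma inv_statE n (s : 'S_n) :
  inv_stat s = (\sum_(i < n) \sum_(j < n) ((i < j)%N && (s j < s i)%N))%N.
Proof.
rewrite pair_big /= /inv_stat cardsE -sum1_card [LHS]big_mkcond /=.
by apply: eq_bigr => p _; rewrite unfold_in /=; case: ifP.
Qed.

Lemma sum_lift_max n (G : 'I_n.+1 -> nat) :
  (\sum_i G i = \sum_(i < n) G (lift ord_max i) + G ord_max)%N.
Proof.
rewrite big_ord_recr /=; congr (_ + _)%N; apply: eq_bigr => i _.
by congr G; apply/val_inj/esym/lift_max.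
Qed.

Lemma inv_append n (s : 'S_n) (v : 'I_n.+1) :
  inv_stat (append s v) = (inv_stat s + (n - v))%N.
Proof.
rewrite !inv_statE sum_lift_max //.
rewrite [X in (_ + X)%N]big1 => [|j _]; last by have := ltn_ord j; rewrite /=; lia.
(* Since [s] is a bijection, its entries that are at least v are as many as the values v, ..., n -
   1. *)
have -> : (n - v = \sum_(i < n) (v <= s i))%N.
  by rewrite -(sum_leq_ord (leq_ord v)) (reindex_inj (@perm_inj _ s)).
rewrite addn0 -[RHS]big_split.
apply: eq_bigr => i _; rewrite sum_lift_max; congr (_ + _)%N.
  by apply: eq_bigr => j _; rewrite !append_lift !ltn_lift.
by rewrite append_lift append_max ltn_lift_self lift_max ltn_ord.
Qed.

(** Pairwise comparisons replace the maximum because [lift] preserves each of them. *)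
Lemma lrm_statE n (s : 'S_n) :
  lrm_stat s = (\sum_(i < n) [forall j : 'I_n, (j <= i)%N ==> (s j <= s i)%N])%N.
Proof.
rewrite /lrm_stat cardsE -sum1_card [LHS]big_mkcond /=.
apply: eq_bigr => i _; rewrite unfold_in /=.
transitivity (nat_of_bool (s i == \max_(j < n | (j <= i)%N) s j :> nat)%N).
  by rewrite eqnE; case: eqP.
congr nat_of_bool.
rewrite eqn_leq.
rewrite (@leq_bigmax_cond _ (fun j : 'I_n => (j <= i)%N) (fun j => s j : nat)) //=.
by apply/bigmax_leqP/forall_inP.
Qed.

Lemma lrm_append n (s : 'S_n) (v : 'I_n.+1) :
  lrm_stat (append s v) = (lrm_stat s + (v == n :> nat))%N.
Proof.
rewrite !lrm_statE sum_lift_max //; congr (_ + nat_of_bool _)%N.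
  apply: eq_bigr => i _; congr nat_of_bool.
  apply/forall_inP/forall_inP => H j.
    have := H (lift ord_max j).
    rewrite !append_lift !lift_max !(leqNgt (lift _ _)) ltn_lift.
    by rewrite -leqNgt.
  case: (unliftP ord_max j) => [j'|] ->; last by have := ltn_ord i; rewrite /= /bump; lia.
  by rewrite !append_lift !lift_max !(leqNgt (lift _ _)) ltn_lift -leqNgt; apply: H.
rewrite append_max; apply/forall_inP/eqP => [H|vn j _]; last first.
  by rewrite vn; exact: leq_ord.
(* Compare the last entry with the position holding the largest value n. *)
have := H ((append s v)^-1 ord_max)%g; rewrite permKV leq_ord /= => /(_ isT).
by have := ltn_ord v; lia.
Qed.

(** * Signed generating functions refined by height *)

Definition signed_weight n (s : 'S_n) : {poly int} :=
  (-1) ^+ inv_stat s * 'X^(lrm_stat s).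

Definition height n (s : 'S_n) : nat := (n - low s)%N.

Definition I_eq n h : {poly int} :=
  \sum_(s in Av321 n | height s == h) signed_weight s.

Definition I_ge n h : {poly int} :=
  \sum_(s in Av321 n | (h <= height s)%N) signed_weight s.

Lemma Ipoly_signE n :
  (Ipoly n).[-1] = \sum_(s in Av321 n) (-1) ^+ inv_stat s * 'X^(lrm_stat s).
Proof.
rewrite /Ipoly horner_sum; apply: eq_bigr => s _.
by rewrite hornerM hornerXn hornerC.
Qed.

Lemma Ipoly_I_ge n : (Ipoly n).[-1] = I_ge n 0.
Proof. by rewrite Ipoly_signE; apply: eq_bigl => s; rewrite leq0n andbT. Qed.

Lemma I_geD n h : I_ge n h = I_eq n h + I_ge n h.+1.
Proof.
rewrite /I_ge (bigID (fun s : 'S_n => height s == h)) /=; congr (_ + _).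
  by apply: eq_bigl => s; rewrite -andbA; congr (_ && _); lia.
by apply: eq_bigl => s; rewrite -andbA; congr (_ && _); lia.
Qed.

Lemma I_ge_eq0 n h : (n < h)%N -> I_ge n h = 0.
Proof.
by move=> nh; rewrite /I_ge big_pred0 // => s; rewrite /height; lia.
Qed.

Lemma I_ge00 : I_ge 0 0 = 1.
Proof.
rewrite /I_ge (big_pred1 1%g) => [|s]; last first.
  rewrite inE leq0n andbT; apply/avoids321P/eqP => [_|_ []//].
  by apply/permP => -[].
rewrite /signed_weight inv_statE lrm_statE !big_ord0 !expr0 mulr1.
by [].
Qed.

Lemma height_append n (s : 'S_n) (v : 'I_n.+1) : (low s <= v)%N ->
  height (append s v) = if v == n :> nat then (height s).+1 else (n - v)%N.
Proof.
move=> lv; rewrite /height low_append //; have := low_le s.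
by case: eqP => //; lia.
Qed.

Lemma signed_weight_append n (s : 'S_n) (v : 'I_n.+1) :
  signed_weight (append s v) =
  (-1) ^+ (n - v) * 'X^(v == n :> nat) * signed_weight s.
Proof.
by rewrite /signed_weight inv_append lrm_append !exprD; ring.
Qed.

(** Appending n raises the height by one, and appending v < n gives height n - v > 0, so no nonempty
    permutation produced has height 0. *)
Lemma I_eqS0 n : I_eq n.+1 0 = 0.
Proof.
rewrite /I_eq big_mkcond sum_append big1 // => s _; rewrite big1 // => v _.
rewrite inE avoids321_append; case: ifP => // /andP[/andP[_ lv]].
rewrite height_append // => /eqP; have := ltn_ord v.
by case: eqP => // vn v_le nv; exfalso; lia.
Qed.

(** Height h + 1 arises in two ways: from height h by appending n, or by appending v = n - (h + 1).
    The latter is allowed exactly when [s] has height at least h + 1, which is why tails over the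
    height appear. *)
Lemma I_eqSS n h :
  I_eq n.+1 h.+1 = 'X * I_eq n h + (-1) ^+ h.+1 * I_ge n h.+1.
Proof.
rewrite /I_eq /I_ge !mulr_sumr [LHS]big_mkcond sum_append.
rewrite [X in _ = X + _]big_mkcond [X in _ = _ + X]big_mkcond -big_split /=.
apply: eq_bigr => s _; rewrite !inE.
have [as321|] := boolP (avoids321 s); last first.
  move=> nas; rewrite addr0 big1 // => v _.
  by rewrite ?inE avoids321_append (negbTE nas).
rewrite big_ord_recr [RHS]addrC; congr (_ + _) => /=; last first.
  rewrite ?inE avoids321_append as321 low_le height_append ?low_le //= eqxx eqSS.
  by rewrite signed_weight_append /= eqxx subnn mul1r.
rewrite (eq_bigr (fun v : 'I_n => if (low s <= v)%N && (n - v == h.+1)%N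
    then (-1) ^+ h.+1 * signed_weight s else 0)) => [|v _]; last first.
  rewrite ?inE avoids321_append as321 /=; case: leqP => //= lv.
  rewrite height_append //= signed_weight_append /= (ltn_eqF (ltn_ord v)).
  by case: eqP => // ->; rewrite mulr1.
rewrite -big_mkcond /height; case: ltnP => [hl|hl].
  have v_lt : (n - h.+1 < n)%N by lia.
  apply: (big_pred1 (Ordinal v_lt)) => v; rewrite /= -val_eqE /=.
  by have := ltn_ord v; lia.
by rewrite big_pred0 // => v; have := ltn_ord v; lia.
Qed.

Lemma I_geSS n h : I_ge n.+1 h.+1 =
  I_ge n.+1 h.+2 + 'X * (I_ge n h - I_ge n h.+1) + (-1) ^+ h.+1 * I_ge n h.+1.
Proof. by rewrite I_geD I_eqSS (I_geD n h); ring. Qed.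

Lemma I_geS0 n : I_ge n.+1 0 = I_ge n.+1 1.
Proof. by rewrite I_geD I_eqS0 add0r. Qed.

(** Tails vanish beyond n + 1, so [I_geSS] determines them by descending h; a guessed solution then
    only has to satisfy the recursion. *)
Lemma I_geS_uniq n (E : nat -> {poly int}) :
    (forall h, (n.+1 < h)%N -> E h = 0) ->
    (forall h, E h.+1 =
       E h.+2 + 'X * (I_ge n h - I_ge n h.+1) + (-1) ^+ h.+1 * I_ge n h.+1) ->
  forall h, I_ge n.+1 h.+1 = E h.+1.
Proof.
move=> E0 ES h; have [d] := ubnP (n.+1 - h); elim: d h => // d IH h hd.
have [nh|hn] := ltnP n.+1 h.+1; first by rewrite E0 // I_ge_eq0.
by rewrite I_geSS ES IH //; lia.
Qed.

(** * Binomial sums and the explicit solution *)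

Definition binsum (a : nat) (F : nat -> {poly int}) : {poly int} :=
  \sum_(i < a.+1) 'C(a, i)%:R * F i.

Lemma eq_binsum a F G : (forall i, F i = G i) -> binsum a F = binsum a G.
Proof. by move=> FG; apply: eq_bigr => i _; rewrite FG. Qed.

(** With S the shift of sequences, [binsum a F] is the value of (1 + S)^a F at 0; one factor 1 + S
    is split off. *)
Lemma binsumS a F : binsum a.+1 F = binsum a F + binsum a (fun i => F i.+1).
Proof.
rewrite /binsum big_ord_recl [in X in _ = X + _]big_ord_recl -addrA !bin0.
congr (_ + _); rewrite (eq_bigr (fun i : 'I_a.+1 => 'C(a, i.+1)%:R * F i.+1 +
  'C(a, i)%:R * F i.+1)) => [|i _]; last by rewrite binS natrD mulrDl.
rewrite big_split /=; congr (_ + _).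
by rewrite big_ord_recr /= bin_small // mul0r addr0.
Qed.

Lemma binsumD a F G : binsum a (fun i => F i + G i) = binsum a F + binsum a G.
Proof. by rewrite /binsum -big_split; apply: eq_bigr => i _; rewrite mulrDr. Qed.

Lemma binsumZ a c F : binsum a (fun i => c * F i) = c * binsum a F.
Proof. by rewrite /binsum mulr_sumr; apply: eq_bigr => i _; rewrite mulrCA. Qed.

Definition bin_pair m p : {poly int} :=
  'X^(2 * p + 1) * ('C(m, p)%:R - 'C(m, p.+1)%:R * 'X).

Lemma bin_pairSS m p :
  bin_pair m.+1 p.+1 = 'X^2 * bin_pair m p + bin_pair m p.+1.
Proof.
rewrite /bin_pair !binS !natrD (_ : 2 * p.+1 + 1 = 2 + (2 * p + 1))%N; last lia.
rewrite exprD; ring.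
Qed.

(* Equal to I_ge (2 * m).+1 (2 * j).+1. *)
Definition Iodd_ge m j : {poly int} :=
  if (j <= m)%N then binsum (m - j) (fun i => bin_pair m (i + j)) else 0.

Lemma Iodd_ge_eq0 m j : (m < j)%N -> Iodd_ge m j = 0.
Proof. by rewrite /Iodd_ge; case: leqP. Qed.

(** Splitting the outer binomial by [binsumS], the shifted half is exactly the next tail. *)
Lemma Iodd_ge_diff m j : (j <= m)%N ->
  Iodd_ge m.+1 j =
    Iodd_ge m.+1 j.+1 + binsum (m - j) (fun i => bin_pair m.+1 (i + j)).
Proof.
move=> jm; rewrite /Iodd_ge ltnS jm leqW // subSn // subSS binsumS addrC.
by congr (_ + _); apply: eq_binsum => i; rewrite addSnnS.
Qed.

(** By [Iodd_ge_diff] the first two tails differ by a [binsum]. Pascal's rule in [bin_pairSS] splits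
    it into t^2 times the difference of the tails j and j + 1 at m, plus the tail j + 1 at m. The
    cases j >= m are checked directly. *)
Lemma Iodd_ge_recS m j :
  Iodd_ge m.+1 j.+1 =
    Iodd_ge m.+1 j.+2 + 'X^2 * Iodd_ge m j + (1 - 'X^2) * Iodd_ge m j.+1.
Proof.
have [mj|jm] := ltnP m j; first by rewrite !Iodd_ge_eq0; [ring|lia..].
have := jm; rewrite leq_eqVlt => /predU1P[<-|{}jm].
  rewrite (Iodd_ge_eq0 (ltnSn j)) (Iodd_ge_eq0 (ltnSn j.+1)).
  rewrite /Iodd_ge !leqnn !subnn /binsum !big_ord_recl !big_ord0 !bin0.
  rewrite /bin_pair !add0n !binn !(bin_small (ltnSn _)).
  rewrite (_ : 2 * j.+1 + 1 = 2 + (2 * j + 1))%N; last lia.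
  rewrite exprD; ring.
case: m jm => // m jm; rewrite (Iodd_ge_diff jm) (@Iodd_ge_diff m j) //.
rewrite subSS (@eq_binsum _ _ (fun i => 'X^2 * bin_pair m.+1 (i + j) +
   bin_pair m.+1 (i + j.+1))) => [|i]; last by rewrite addnS bin_pairSS.
rewrite binsumD binsumZ.
have -> : Iodd_ge m.+1 j.+1 = binsum (m - j) (fun i => bin_pair m.+1 (i + j.+1)).
  by rewrite /Iodd_ge jm subSS.
ring.
Qed.

Lemma Iodd_ge_rec0 m : Iodd_ge m.+1 0 = Iodd_ge m.+1 1 + (1 - 'X) * Iodd_ge m 0.
Proof.
rewrite Iodd_ge_diff //; congr (_ + _); apply/eqP.
rewrite -subr_eq0 /Iodd_ge leq0n subn0.
rewrite -binsumZ /binsum -sumrB; apply/eqP.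
(* The two sums do not agree termwise, but their difference telescopes: the partial sums are - c N,
   and c (m + 1) = 0 because C(m, m+1) = 0. *)
pose c p : {poly int} :=
  if p is q.+1 then 'C(m, q)%:R * 'C(m, p)%:R * 'X^(2 * p + 1) else 0.
have tele N : \sum_(i < N) ('C(m, i)%:R * bin_pair m.+1 (i + 0) -
    'C(m, i)%:R * ((1 - 'X) * bin_pair m (i + 0))) = - c N.
  elim: N => [|N IH]; first by rewrite big_ord0 oppr0.
  have XE k : 'X^(2 * k + 1) = 'X^2 ^+ k * 'X :> {poly int} by rewrite exprD exprM.
  rewrite big_ord_recr IH /= addn0 /bin_pair.
  by case: N {IH} => [|N]; rewrite /c !XE !exprS ?binS ?bin0 !natrD; ring.
by rewrite tele /c /= (bin_small (ltnSn m)) mulr0 mul0r oppr0.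
Qed.

Lemma even_or_odd n : exists j, n = j.*2 \/ n = j.*2.+1.
Proof. by exists n./2; lia. Qed.

Lemma signr_double (R : pzRingType) j : (-1) ^+ j.*2 = 1 :> R.
Proof. by rewrite -signr_odd odd_double. Qed.

Definition double_simp := (doubleK, uphalf_double, odd_double, signr_double).

(** The halved index in the hypothesis says that at odd length the tails from 2j and 2j + 1
    coincide, that is, even heights cancel. The case h = 0 of the conclusion yields the factor t -
    1. *)
Lemma I_ge_even m :
    (forall h, I_ge (2 * m).+1 h.+1 = Iodd_ge m (h.+1)./2) ->
  forall h, I_ge (2 * m).+2 h.+1 = ('X - (~~ odd h)%:R) * Iodd_ge m h./2.
Proof.
move=> IU; pose E h := ('X - (odd h)%:R) * Iodd_ge m (h.-1)./2.
apply: (@I_geS_uniq _ E) => [h mh|h]; first by rewrite /E Iodd_ge_eq0 ?mulr0 //; lia.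
rewrite /E; have [j [->|->]] := even_or_odd h.
  (* The hypothesis does not reach index 0, where [I_geS0] is used instead. *)
  have -> : I_ge (2 * m).+1 j.*2 = Iodd_ge m j.
    by case: j => [|j]; rewrite ?I_geS0 ?doubleS IU /= ?double_simp.
  by rewrite IU /= exprS !double_simp /=; ring.
by rewrite !IU /= !exprS !double_simp /=; ring.
Qed.

Lemma I_ge_odd m h : I_ge (2 * m).+1 h.+1 = Iodd_ge m (h.+1)./2.
Proof.
elim: m h => [|m IH] h.
  apply: (@I_geS_uniq _ (fun h => Iodd_ge 0 h./2)) => {}h.
    by move=> h1; rewrite Iodd_ge_eq0 //; lia.
  case: h => [|h].
    rewrite I_ge00 I_ge_eq0 // /Iodd_ge /= /binsum.
    rewrite big_ord_recl big_ord0 /bin_pair !bin0 bin_small //.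
    by ring.
  by rewrite !I_ge_eq0 //= !Iodd_ge_eq0 //; ring.
rewrite mulnS !addSn add0n.
apply: (@I_geS_uniq _ (fun h => Iodd_ge m.+1 h./2)) => {}h.
  by move=> mh; rewrite Iodd_ge_eq0 //; lia.
have Ie := I_ge_even IH.
(* For odd h the two tails at m + 1 agree and the other terms cancel; even h needs [Iodd_ge_rec0] or
   [Iodd_ge_recS]. *)
rewrite /=; have [j [->|->]] := even_or_odd h; last first.
  rewrite !Ie /= !exprS !double_simp /=; ring.
case: j => [|j]; first by rewrite I_geS0 !Ie /= Iodd_ge_rec0; ring.
by rewrite doubleS !Ie /= !exprS !double_simp /= Iodd_ge_recS; ring.
Qed.

Definition Iodd m : {poly int} := binsum m (bin_pair m).

Lemma Iodd_geE0 m : Iodd_ge m 0 = Iodd m.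
Proof. by rewrite /Iodd_ge leq0n subn0; apply: eq_binsum => i; rewrite addn0. Qed.

Lemma Ipoly_odd m : (Ipoly (2 * m).+1).[-1] = Iodd m.
Proof. by rewrite Ipoly_I_ge I_geS0 I_ge_odd Iodd_geE0. Qed.

Lemma Ipoly_even m : (Ipoly (2 * m).+2).[-1] = ('X - 1) * Iodd m.
Proof. by rewrite Ipoly_I_ge I_geS0 (I_ge_even (@I_ge_odd m)) Iodd_geE0. Qed.

(** * Coefficients and the closed form *)

Lemma sum_delta (R : pzRingType) N (F : nat -> R) p :
  ((N <= p)%N -> F p = 0) -> \sum_(i < N) F i * (p == i)%:R = F p.
Proof.
move=> Fp0; have [Np|pN] := leqP N p.
  by rewrite Fp0 // big1 // => i _; rewrite gtn_eqF ?mulr0 //; have := ltn_ord i; lia.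
rewrite (bigD1 (Ordinal pN)) //= eqxx mulr1 big1 ?addr0 // => i.
by rewrite -val_eqE eq_sym => /negbTE /= ->; rewrite mulr0.
Qed.

Lemma coef_bin_pair m i k : (bin_pair m i)`_k =
  'C(m, i)%:R * (k == 2 * i + 1)%N%:R - 'C(m, i.+1)%:R * (k == 2 * i + 2)%N%:R.
Proof.
rewrite /bin_pair (_ : _ * _ = 'C(m, i)%:R * 'X^(2 * i + 1) -
  'C(m, i.+1)%:R * 'X^(2 * i + 2)).
  by rewrite coefB -!polyC_natr !coefCM !coefXn.
by rewrite (_ : 2 * i + 2 = (2 * i + 1).+1)%N ?exprS; [ring|lia].
Qed.

Lemma coef_Iodd m k : (Iodd m)`_k = \sum_(i < m.+1) 'C(m, i)%:R * (bin_pair m i)`_k.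
Proof.
rewrite /Iodd /binsum coef_sum; apply: eq_bigr => i _.
by rewrite -polyC_natr coefCM.
Qed.

Lemma coef_Iodd0 m : (Iodd m)`_0 = 0.
Proof.
by rewrite coef_Iodd big1 // => i _; rewrite coef_bin_pair !addnS /=; ring.
Qed.

Lemma coef_Iodd_odd m p : (Iodd m)`_(p.*2.+1) = 'C(m, p)%:R ^+ 2.
Proof.
rewrite coef_Iodd -[RHS](@sum_delta _ m.+1 (fun i => 'C(m, i)%:R ^+ 2)).
  apply: eq_bigr => i _; rewrite coef_bin_pair.
  have -> : (p.*2.+1 == 2 * i + 1)%N = (p == i) by lia.
  have -> : (p.*2.+1 == 2 * i + 2)%N = false by lia.
  by rewrite mulr0 subr0 mulrA.
by move=> mp; rewrite bin_small ?mul0r.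
Qed.

Lemma coef_Iodd_even m p : (Iodd m)`_(p.*2.+2) = - ('C(m, p) * 'C(m, p.+1))%:R.
Proof.
rewrite coef_Iodd -[RHS](@sum_delta _ m.+1 (fun i => - ('C(m, i) * 'C(m, i.+1))%:R)).
  apply: eq_bigr => i _; rewrite coef_bin_pair natrM.
  have -> : (p.*2.+2 == 2 * i + 1)%N = false by lia.
  have -> : (p.*2.+2 == 2 * i + 2)%N = (p == i) by lia.
  by rewrite mulr0; ring.
by move=> mp; rewrite bin_small ?mul0n ?oppr0.
Qed.

Lemma s_coef_eq0 n k : (0 < n)%N -> (n <= k)%N -> s_coef n k.+1 = 0%N.
Proof.
rewrite /s_coef subSS subn0 => n0 nk; case: (ltnP (n - 1)./2 k./2) => [h|h].
  by rewrite bin_small.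
(* Here k = n is odd: the floors of the halves agree, but the ceilings differ. *)
by rewrite mulnC bin_small //; lia.
Qed.

Definition closed_form n : {poly int} :=
  \sum_(1 <= k < n.+1) (-1) ^+ (n - k) * (s_coef n k)%:R * 'X^k.

Lemma closed_formE n :
  closed_form n = \sum_(i < n) ((-1) ^+ (n - i.+1) * (s_coef n i.+1)%:R)%:P * 'X^(i.+1).
Proof.
rewrite /closed_form big_add1 big_mkord; apply: eq_bigr => i _.
by rewrite polyCM polyC_exp polyCN polyC_natr.
Qed.

Lemma coef_closed_form0 n : (closed_form n)`_0 = 0.
Proof.
rewrite closed_formE coef_sum big1 // => i _.
by rewrite coefCM coefXn mulr0.
Qed.

Lemma coef_closed_formS n k : (0 < n)%N ->
  (closed_form n)`_k.+1 = (-1) ^+ (n - k.+1) * (s_coef n k.+1)%:R.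
Proof.
move=> n0; rewrite closed_formE coef_sum.
rewrite -[RHS](@sum_delta _ n (fun i => (-1) ^+ (n - i.+1) * (s_coef n i.+1)%:R)).
  by apply: eq_bigr => i _; rewrite coefCM coefXn eqSS.
by move=> nk; rewrite s_coef_eq0 ?mulr0.
Qed.

Lemma Iodd_closed_form m : Iodd m = closed_form (2 * m).+1.
Proof.
apply/polyP => -[|k]; first by rewrite coef_Iodd0 coef_closed_form0.
rewrite coef_closed_formS // /s_coef !subSS !subn0 mul2n.
have [j [->|->]] := even_or_odd k;
  rewrite ?coef_Iodd_odd ?coef_Iodd_even -?doubleB /= !double_simp.
  by rewrite natrM; ring.
(* For m <= j the sign exponent truncates to 0, but both sides vanish with C(m, j+1). *)
have [mj|jm] := leqP m j; first by rewrite (@bin_small m j.+1) // muln0; ring.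
by rewrite (_ : _ - _ = (m - j.+1).*2.+1)%N ?exprS ?double_simp; [ring|lia].
Qed.

(** Multiplying by t - 1 combines neighbouring coefficients, which share a factor C(m, j); Pascal's
    rule merges the cofactors into an entry of row m + 1. *)
Lemma Ieven_closed_form m : ('X - 1) * Iodd m = closed_form (2 * m).+2.
Proof.
rewrite mulrBl mul1r; apply/polyP => -[|k]; rewrite coefB coefXM /=.
  by rewrite coef_Iodd0 coef_closed_form0.
rewrite coef_closed_formS // /s_coef !subSS !subn0 mul2n.
have [j [->|->]] := even_or_odd k; rewrite /= !double_simp; last first.
  rewrite coef_Iodd_odd coef_Iodd_even !subSS -doubleB double_simp binS !natrM natrD; ring.
rewrite coef_Iodd_odd; have [mj|jm] := ltnP m j.
  case: j mj => // j mj; rewrite doubleS coef_Iodd_even !(bin_small mj).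
  by rewrite muln0 mul0n; ring.
rewrite (_ : _ - _ = (m - j).*2.+1)%N ?exprS ?double_simp; last lia.
case: j {jm} => [|j]; first by rewrite coef_Iodd0 !bin0; ring.
by rewrite doubleS coef_Iodd_even binS !natrM natrD; ring.
Qed.

(** * The three-term recurrence *)

(* Prepending zeros to a row of Pascal's triangle (and to the coefficients of
   Iodd m below) avoids boundary cases in the three-term recurrence. *)
Definition bin3 (m p : nat) : int := if (p < 3)%N then 0 else ('C(m, p - 3))%:R.

Lemma bin3S m p : bin3 m.+1 p.+1 = bin3 m p + bin3 m p.+1.
Proof.
rewrite /bin3; case: p => [|[|[|p]]] //=; first by rewrite !bin0.
by rewrite !subSS !subn0 binS natrD addrC.
Qed.

(** This is (q + 1) C(m, q+1) = (m - q) C(m, q) with q = p - 3. Over the integers it also holds in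
    the padding: at p = 2 the left factor is zero. *)
Lemma bin3_rec m p :
  (p%:R - 2) * bin3 m p.+1 = (m%:R + 3 - p%:R) * bin3 m p.
Proof.
rewrite /bin3; case: p => [|[|[|p]]] //=; rewrite ?subSS ?subn0; try ring.
have /(congr1 (fun k => k%:R : int)) := mul_bin_left m p.
rewrite !natrM; case: (leqP p m) => [pm|mp] e.
  transitivity (p.+1%:R * ('C(m, p.+1)%:R : int)); first by ring.
  by rewrite e natrB //; ring.
by rewrite !bin_small //; first ring; lia.
Qed.

(** The offset 6 is twice that of [bin3], so parity is kept and both share the index p. *)
Definition Iodd_coef6 m k : int := if (k < 6)%N then 0 else (Iodd m)`_(k - 6).

Lemma Iodd_coef6_odd m p : Iodd_coef6 m p.*2.+1 = bin3 m p ^+ 2.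
Proof.
rewrite /Iodd_coef6 /bin3; case: (ltnP p 3) => p3; first by rewrite ifT //; lia.
by rewrite ifF; [rewrite (_ : _ - _ = (p - 3).*2.+1)%N ?coef_Iodd_odd; lia|lia].
Qed.

Lemma Iodd_coef6_even m p : Iodd_coef6 m p.*2.+2 = - (bin3 m p * bin3 m p.+1).
Proof.
rewrite /Iodd_coef6 /bin3; case: (ltnP p 2) => p2.
  by rewrite !ifT; [ring|lia..].
have [->|p2'] := eqVneq p 2; first by rewrite /= coef_Iodd0; ring.
rewrite !ifF; [|lia..].
rewrite (_ : _ - 6 = (p - 3).*2.+2)%N ?coef_Iodd_even; last lia.
by rewrite (_ : p.+1 - 3 = (p - 3).+1)%N ?natrM; last lia.
Qed.

Lemma coef_IoddMXn m i j k : (i + j = k + 6)%N -> (j <= 4)%N ->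
  (Iodd m * 'X^j)`_k = Iodd_coef6 m i.
Proof.
move=> ijk j4; rewrite coefMXn /Iodd_coef6.
case: ltnP => kj; first by rewrite ifT //; lia.
by rewrite ifF; [congr (_`_ _)|]; lia.
Qed.

(** Pascal's rule brings everything to neighbouring entries of row m. The difference of the two
    sides is then a combination of two instances of [bin3_rec], with the cofactors written out in
    each [transitivity]. *)
Lemma Iodd_coef6_rec m k :
  m.+3%:R * Iodd_coef6 m.+2 k.+1.+4 =
  2 * m.+2%:R * (Iodd_coef6 m.+1 k.+1.+4 + Iodd_coef6 m.+1 k.+1.+2)
  - 2 * Iodd_coef6 m.+1 k.+1.+3
  - m.+1%:R * (Iodd_coef6 m k.+1.+4 - 2 * Iodd_coef6 m k.+1.+2 + Iodd_coef6 m k.+1).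
Proof.
have [p kE] := even_or_odd k; have e1 := bin3_rec m p.
have e2 := bin3_rec m p.+1; have e3 := bin3_rec m p.+2.
case: kE => ->.
  rewrite !(Iodd_coef6_odd _ p.+2) !(Iodd_coef6_odd _ p.+1) !(Iodd_coef6_odd _ p).
  rewrite !(Iodd_coef6_even _ p.+1) !bin3S.
  set x := bin3 m p in e1 *; set y := bin3 m p.+1 in e1 e2 *.
  set z := bin3 m p.+2 in e2 *; rewrite -(natr1 p) in e2.
  apply/eqP; rewrite -subr_eq0; apply/eqP.
  transitivity (2 * (x + y) * ((p%:R + 1 - 2) * z - (m%:R + 3 - (p%:R + 1)) * y)
    - 2 * (y + z) * ((p%:R - 2) * y - (m%:R + 3 - p%:R) * x)); first by ring.
  by rewrite e1 e2 !subrr !mulr0 subrr.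
rewrite !(Iodd_coef6_even _ p.+2) !(Iodd_coef6_even _ p.+1) !(Iodd_coef6_even _ p).
rewrite !(Iodd_coef6_odd _ p.+2) !bin3S.
set x := bin3 m p in e1 *; set y := bin3 m p.+1 in e1 *.
set z := bin3 m p.+2 in e3 *; set w := bin3 m p.+3 in e3 *.
rewrite -(natr1 p.+1) -(natr1 p) in e3.
apply/eqP; rewrite -subr_eq0; apply/eqP.
transitivity ((z + w) * ((p%:R - 2) * y - (m%:R + 3 - p%:R) * x)
  - (x + y) * ((p%:R + 1 + 1 - 2) * w - (m%:R + 3 - (p%:R + 1 + 1)) * z)).
  by ring.
by rewrite e1 e3 !subrr !mulr0 subrr.
Qed.

Lemma Iodd_small : Iodd 0 = 'X /\ Iodd 1 = 'X - 'X^2 + 'X^3.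
Proof.
rewrite /Iodd /binsum /bin_pair !big_ord_recl !big_ord0 /= !bin0 binn !bin_small //.
by split; ring.
Qed.

Lemma Iodd_rec m :
  m.+3%:R * Iodd m.+2 = 2%:R * ((1 + 'X^2) * m.+2%:R - 'X) * Iodd m.+1
    - (1 - 'X^2) ^+ 2 * m.+1%:R * Iodd m.
Proof.
apply/polyP => k.
(* Both sides become integer combinations of [Iodd _ * 'X^j], so that [coef_IoddMXn] reads off every
   coefficient uniformly. *)
have -> : m.+3%:R * Iodd m.+2 = (m.+3%:R : int) *: (Iodd m.+2 * 'X^0).
  by rewrite -mul_polyC polyC_natr; ring.
have -> : 2%:R * ((1 + 'X^2) * m.+2%:R - 'X) * Iodd m.+1
    - (1 - 'X^2) ^+ 2 * m.+1%:R * Iodd m =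
  (2 * m.+2%:R : int) *: (Iodd m.+1 * 'X^0 + Iodd m.+1 * 'X^2)
  - (2 : int) *: (Iodd m.+1 * 'X^1)
  - (m.+1%:R : int) *: (Iodd m * 'X^0 - (2 : int) *: (Iodd m * 'X^2) + Iodd m * 'X^4).
  by rewrite -!mul_polyC polyCM !polyC_natr; ring.
rewrite !(coefB, coefD, coefZ).
have X0 n : (Iodd n * 'X^0)`_k = Iodd_coef6 n k.+2.+4 by apply: coef_IoddMXn; lia.
have X1 n : (Iodd n * 'X^1)`_k = Iodd_coef6 n k.+2.+3 by apply: coef_IoddMXn; lia.
have X2 n : (Iodd n * 'X^2)`_k = Iodd_coef6 n k.+2.+2 by apply: coef_IoddMXn; lia.
have X4 n : (Iodd n * 'X^4)`_k = Iodd_coef6 n k.+2 by apply: coef_IoddMXn; lia.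
(* Coefficient k has padded index k + 6 = (k + 1) + 5. *)
rewrite !X0 X1 !X2 X4; exact: (Iodd_coef6_rec m k.+1).
Qed.

Theorem theorem9p2 :
  (forall n : nat, (1 <= n)%N ->
     (Ipoly n).[-1] =
       \sum_(s in Av321 n) (-1) ^+ inv_stat s * 'X^(lrm_stat s) :> {poly int}
     /\
     (Ipoly n).[-1] =
       \sum_(1 <= k < n.+1) (-1) ^+ (n - k) * (s_coef n k)%:R * 'X^k
         :> {poly int})
  /\
  (forall n : nat, (1 <= n)%N ->
     (Ipoly (2 * n)%N).[-1] = ('X - 1) * (Ipoly (2 * n - 1)%N).[-1]
     /\
     (n + 1)%:R * (Ipoly (2 * n + 1)%N).[-1] =
       2%:R * ((1 + 'X^2) * n%:R - 'X) * (Ipoly (2 * n - 1)%N).[-1]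
       - (1 - 'X^2) ^+ 2 * (n - 1)%:R * (Ipoly (2 * n - 3)%N).[-1]).
Proof.
split=> [n n0|[//|m] _].
  split; first exact: Ipoly_signE.
  have [m [E|E]] := even_or_odd n.-1.
    have -> : n = (2 * m).+1 by lia.
    by rewrite Ipoly_odd Iodd_closed_form.
  have -> : n = (2 * m).+2 by lia.
  by rewrite Ipoly_even Ieven_closed_form.
have -> : (2 * m.+1 - 1 = (2 * m).+1)%N by lia.
have -> : (2 * m.+1 + 1 = (2 * m.+1).+1)%N by lia.
have -> : (2 * m.+1 = (2 * m).+2)%N by lia.
rewrite Ipoly_even Ipoly_odd; split => //.
rewrite (_ : (2 * m).+3 = (2 * m.+1).+1)%N ?Ipoly_odd; last lia.
(* For n = 1 the index 2n - 3 truncates to 0, and the factor n - 1 = 0 removes that term. *)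
case: m => [|m].
  have [-> ->] := Iodd_small; rewrite subnn; ring.
rewrite (_ : (2 * m.+1).+2 - 3 = (2 * m).+1)%N ?Ipoly_odd; last lia.
by rewrite addn1 subn1 Iodd_rec.
Qed.
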